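(* Let $M$ be a simple matroid on $[n]$ of rank $\ell\ge3$. If $M$ is $3$-independent, then $M$ is line-closed.
   Context: A simple matroid has no loops and no nontrivial parallel classes; $[n]=\{1,\dots,n\}$. For $3\le p\le \ell+1$, a partition $\pi$ of $[n]$ is $p$-independent if, whenever one chooses at most $p$ parts of $\pi$ and one element from each of them, the chosen elements form an independent set of $M$. A partition is independent if it is $(\ell+1)$-independent. For $3\le p\le\ell$, the matroid $M$ is $p$-independent if every $p$-independent partition of $[n]$ is independent. A subset $S\subset[n]$ is line-closed if for every $3$-element dependent set (3-circuit) $C$ of $M$ with $|S\cap C|\ge2$ one has $C\subset S$. The matroid $M$ is line-closed if every line-closed subset of $[n]$ is a flat of $M$. *)

(* Defs.v *)
From mathcomp Require Import all_boot.

Set Implicit Arguments.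
Unset Strict Implicit.
Unset Printing Implicit Defensive.

Record matroid (T : finType) := Matroid {
  indep : {set {set T}};
  indep_set0 : set0 \in indep;
  indep_sub : forall I J : {set T}, I \subset J -> J \in indep -> I \in indep;
  indep_aug : forall I J : {set T}, I \in indep -> J \in indep -> #|I| < #|J| ->
    exists2 x, x \in J :\: I & x |: I \in indep
}.

Section MatroidTheory.
Variables (T : finType) (M : matroid T).
Implicit Types (A S C : {set T}) (P : {set {set T}}) (p : nat) (x y : T).

Definition dependent A : bool := A \notin indep M.

Definition rank_of A : nat := \max_(I in indep M | I \subset A) #|I|.

Definition matroid_rank : nat := rank_of [set: T].

Definition closure_of A : {set T} := [set x | rank_of (x |: A) == rank_of A].

Definition flat A : bool := closure_of A == A.

Definition is_loop x : bool := dependent [set x].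

Definition parallel x y : bool :=
  [&& ~~ is_loop x, ~~ is_loop y, x != y & dependent [set x; y]].

Definition simple_matroid : Prop :=
  (forall x, ~~ is_loop x) /\ (forall x y, ~~ parallel x y).

(* Q is the set of chosen parts, and f picks an element of each of them; the
   values of f outside Q are irrelevant. *)
Definition p_indep_partition p P : Prop :=
  partition P [set: T] /\
  forall (Q : {set {set T}}) (f : {set T} -> T),
    Q \subset P -> #|Q| <= p -> (forall B, B \in Q -> f B \in B) ->
    f @: Q \in indep M.

Definition indep_partition P : Prop := p_indep_partition matroid_rank.+1 P.

(* Meant for 3 <= p <= matroid_rank. *)
Definition p_indep_matroid p : Prop :=
  forall P, p_indep_partition p P -> indep_partition P.

Definition line_closed_set S : Prop :=
  forall C, #|C| = 3 -> dependent C -> 2 <= #|S :&: C| -> C \subset S.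

Definition line_closed_matroid : Prop :=
  forall S, line_closed_set S -> flat S.

End MatroidTheory.

(* Main.v *)
(** If a chain of line-closed sets ends at the whole ground set, the successive
    differences form a 3-independent partition: a dependent triple with
    representatives in three different parts would have its two lowest members
    in a line-closed set that misses the highest one.

    Let S be line-closed, let b_1, ..., b_r be a basis of S, and suppose that x
    lies in the closure of S but not in S.  Apply this to the chain of the sets
    S :&: cl {b_1, ..., b_i}, i <= r, followed by the ground set.  The elements
    b_1, ..., b_r, x lie in different parts of the resulting partition, so they
    are independent by 3-independence of the matroid, although x depends on
    b_1, ..., b_r. *)

Require Import Defs.
From mathcomp Require Import all_boot.

Set Implicit Arguments.
Unset Strict Implicit.
Unset Printing Implicit Defensive.

Section MatroidFacts.
Variables (T : finType) (M : matroid T).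
Implicit Types (I J K S C : {set T}) (x y : T).

(** Repeated augmentation of [I] from [J], by induction on the truncated difference
    [#|J| - #|I|]. *)
Lemma indep_extend I J : I \in indep M -> J \in indep M ->
  exists K, [/\ K \in indep M, I \subset K, K \subset I :|: J & #|J| <= #|K|].
Proof.
move=> + indJ.
elim: {I}(#|J| - #|I|) {-2}I (erefl (#|J| - #|I|)) => [|k IHk] I cardI indI.
  exists I; rewrite indI subxx subsetUl; split=> //.
  by rewrite -subn_eq0 cardI.
have ltIJ : #|I| < #|J| by rewrite -subn_gt0 cardI.
have [x /setDP[xJ xI] indxI] := indep_aug indI indJ ltIJ.
have [|K [indK sxIK sKxI leJK]] := IHk (x |: I) _ indxI.
  by rewrite cardsU1 xI add1n subnS cardI.
exists K; split=> //; first exact: subset_trans (subsetUr _ _) sxIK.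
apply: subset_trans sKxI _.
by rewrite !subUset sub1set in_setU xJ orbT subsetUl subsetUr.
Qed.

Lemma simple_indep_card_lt3 I : simple_matroid M -> #|I| < 3 -> I \in indep M.
Proof.
case=> noloop nopar; case E: #|I| => [|[|[|m]]] // _.
- by rewrite (cards0_eq E) indep_set0.
- by move/eqP: E => /cards1P[x ->]; move: (noloop x); rewrite negbK.
- move/eqP: E => /cards2P[x [y [xy ->]]].
  by have := nopar x y; rewrite /parallel !noloop xy negbK.
Qed.

Lemma rank_ofP S :
  exists I, [/\ I \in indep M, I \subset S & #|I| = rank_of M S].
Proof.
rewrite /rank_of.
have P0 : (set0 \in indep M) && (set0 \subset S) by rewrite indep_set0 sub0set.
have card_gt0 : 0 < #|[pred I | (I \in indep M) && (I \subset S)]|.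
  by apply/card_gt0P; exists set0; rewrite inE.
have [I /andP[indI sIS] maxI] := eq_bigmax_cond (fun I : {set T} => #|I|) card_gt0.
by exists I; split=> //; rewrite -maxI; apply: eq_bigl => J; rewrite inE.
Qed.

Lemma leq_rank_of I S : I \in indep M -> I \subset S -> #|I| <= rank_of M S.
Proof.
move=> indI sIS.
by rewrite /rank_of (bigD1 I) ?indI //= leq_maxl.
Qed.

(* The closure of I when I is independent; for dependent I it is all of T. *)
Definition span I : {set T} := [set y | (y \in I) || (y |: I \notin indep M)].

Lemma sub_span I : I \subset span I.
Proof. by apply/subsetP => y yI; rewrite inE yI. Qed.

Lemma spanS I J : I \subset J -> span I \subset span J.
Proof.
move=> sIJ; apply/subsetP => y; rewrite !inE => /orP[/(subsetP sIJ)-> //|dep].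
by apply/orP; right; apply: contra dep; apply: indep_sub (setUS _ sIJ).
Qed.

(** If some [c] in [C] escaped [span I], then [c |: I] would be independent, and the other two
    points of [C] could be extended from it to an independent set larger than [I]. That set avoids
    the point [c], as [C] is dependent, so augmenting [I] from it contradicts the definition of
    [span]. *)
Lemma line_closed_span I :
  simple_matroid M -> I \in indep M -> line_closed_set M (span I).
Proof.
move=> simpleM indI C C3 depC le2; apply/subsetP => c cC.
apply/negPn/negP => cspan.
have /andP[cI indcI] : (c \notin I) && (c |: I \in indep M).
  by move: cspan; rewrite inE negb_or negbK.
rewrite setIC in le2.
set D := C :&: span I in le2.
have cD : c \notin D by rewrite inE negb_and cspan orbT.
have DC : c |: D = C.
  apply/eqP; rewrite eqEcard subUset sub1set cC subsetIl /=.
  by rewrite cardsU1 cD C3.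
have indD : D \in indep M.
  by apply: simple_indep_card_lt3 => //; rewrite -C3 -DC cardsU1 cD.
have [K [indK sDK sKD leK]] := indep_extend indD indcI.
have cK : c \notin K.
  apply: contra depC => cK; apply: indep_sub indK.
  by rewrite -DC subUset sub1set cK.
have ltIK : #|I| < #|K| by move: leK; rewrite cardsU1 cI.
have [z /setDP[zK zI] indzI] := indep_aug indI indK ltIK.
(* Since [D] lies in [span I] and [z] is not in [I], only [z = c] is left. *)
have := subsetP sKD z zK.
rewrite !inE (negPf zI) indzI andbF /= orbF => /eqP zc.
by rewrite -zc zK in cK.
Qed.

(** Take [I] a largest independent subset of [S] and [x] in the closure but outside [S]: an
    independent [x |: I] would exceed the rank of [x |: S], which equals that of [S]. *)
Lemma notin_flat S : ~~ flat M S ->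
  exists x I, [/\ x \notin S, I \in indep M, I \subset S, S \subset span I
                & x |: I \notin indep M].
Proof.
have [I [indI sIS cardI]] := rank_ofP S.
have subS : S \subset closure_of M S.
  by apply/subsetP => y yS; rewrite inE (setUidPr _) ?sub1set.
rewrite /flat eqEsubset subS andbT => /subsetPn[x]; rewrite inE => /eqP rx xS.
exists x, I; split=> //.
  apply/subsetP => y yS; rewrite inE; have [//|yI] := boolP (y \in I) => /=.
  apply/negP => indyI; have := @leq_rank_of (y |: I) S indyI.
  by rewrite subUset sub1set yS sIS -cardI cardsU1 yI ltnn => /(_ isT).
apply/negP => indxI; have := leq_rank_of indxI (setUS [set x] sIS).
rewrite rx -cardI cardsU1; have [xI|] := boolP (x \in I); last by rewrite ltnn.
by rewrite (subsetP sIS x xI) in xS.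
Qed.

Lemma line_closed_setI S1 S2 :
  line_closed_set M S1 -> line_closed_set M S2 -> line_closed_set M (S1 :&: S2).
Proof.
move=> lc1 lc2 C C3 depC le2; rewrite subsetI.
by rewrite lc1 ?lc2 //; apply: leq_trans le2 (subset_leq_card _);
   rewrite setSI ?subsetIl ?subsetIr.
Qed.

Lemma mem_preim_partition (level : T -> nat) B y z :
  B \in preim_partition level [set: T] -> y \in B -> z \in B ->
  level y = level z.
Proof.
by case/imsetP=> t _ ->; rewrite !inE /= => /eqP <- /eqP.
Qed.

Lemma preim_partition_3indep (level : T -> nat) :
  simple_matroid M ->
  (forall i, line_closed_set M [set y | level y < i]) ->
  p_indep_partition M 3 (preim_partition level [set: T]).
Proof.
move=> simpleM lc; split=> [|Q f sQP Q3 fQ]; first exact: preim_partitionP.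
set C := f @: Q.
have [ltC|geC] := ltnP #|C| 3; first exact: simple_indep_card_lt3.
have C3 : #|C| = 3.
  by apply/eqP; rewrite eqn_leq geC (leq_trans (leq_imset_card _ _) Q3).
(* Points of equal level share a part, and [f] picks one point per part. *)
have level_inj : {in C &, injective level}.
  move=> _ _ /imsetP[B BQ ->] /imsetP[D DQ ->] eqBD; congr (f _).
  have /imsetP[t _ Bt] := subsetP sQP B BQ.
  have /imsetP[u _ Du] := subsetP sQP D DQ.
  have := fQ B BQ; have := fQ D DQ.
  rewrite {2}Bt {2}Du !inE /= => /eqP lu /eqP lt.
  by rewrite Bt Du; apply/setP => v; rewrite !inE lu lt eqBD.
have [c0 c0C] : exists c, c \in C by apply/card_gt0P; rewrite C3.
apply/negPn/negP => depC.
(* With [c] of highest level, injectivity puts the other two points strictly below it. *)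
case: (arg_maxnP level c0C) => c cC maxc.
have sC : C :\ c \subset [set y | level y < level c] :&: C.
  apply/subsetP => y /setD1P[yc yC]; rewrite !inE yC andbT ltn_neqAle.
  have -> : level y <= level c by exact: maxc.
  rewrite andbT; apply: contra yc => /eqP eqyc.
  by rewrite (level_inj y c).
have le2 : 2 <= #|[set y | level y < level c] :&: C|.
  by apply: leq_trans (subset_leq_card sC); rewrite cardsDS ?sub1set // C3 cards1.
by have /subsetP/(_ c cC) := lc _ C C3 depC le2; rewrite inE ltnn.
Qed.

(** Distinct levels make [K] a transversal of the parts it meets, hence the image of a choice
    function. *)
Lemma indep_of_level (level : T -> nat) K :
  indep_partition M (preim_partition level [set: T]) ->
  {in K &, injective level} -> #|K| <= (matroid_rank M).+1 -> K \in indep M.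
Proof.
set P := preim_partition _ _ => -[partP indP] injK leK.
have covP y : y \in cover P by rewrite (cover_partition partP) inE.
have [->|/set0Pn[x0 _]] := eqVneq K set0; first exact: indep_set0.
(* The default [x0] is only reached on parts that miss [K]. *)
pose f (B : {set T}) := odflt x0 [pick y in K :&: B].
have fK y : y \in K -> f (pblock P y) = y.
  move=> yK; rewrite /f; case: pickP => [z|/(_ y)]; last first.
    by rewrite inE yK mem_pblock covP.
  rewrite inE => /andP[zK zB] /=; apply: injK => //.
  apply: (@mem_preim_partition _ (pblock P y)) => //; first exact: pblock_mem.
  by rewrite mem_pblock.
have -> : K = f @: (pblock P @: K).
  by rewrite -imset_comp -[LHS]imset_id; apply: eq_in_imset => y yK; rewrite /= fK.
apply: indP.
- by apply/subsetP => _ /imsetP[y _ ->]; exact: pblock_mem.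
- exact: leq_trans (leq_imset_card _ _) leK.
- by move=> _ /imsetP[y yK ->]; rewrite fK // mem_pblock.
Qed.

(** The level of a point is the first index at which it enters the chain. *)
Lemma chain_level (A : nat -> {set T}) m :
  {homo A : i j / i <= j >-> i \subset j} -> A m = [set: T] ->
  exists level : T -> nat, forall y i, (level y <= i) = (y \in A i).
Proof.
move=> homoA Am.
have exA y : exists i, y \in A i by exists m; rewrite Am inE.
exists (fun y => ex_minn (exA y)) => y i.
case: ex_minnP => k yk mink; apply/idP/idP => [le_ki|/mink //].
exact: subsetP (homoA _ _ le_ki) y yk.
Qed.

Lemma three_indep_line_closed :
  simple_matroid M -> p_indep_matroid M 3 -> line_closed_matroid M.
Proof.
move=> simpleM indM S lcS; apply/negPn/negP.
move=> /notin_flat[x [I [xS indI sIS sSI depxI]]].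
have xI : x \notin I by apply: contra xS; exact: subsetP.
pose J i := [set y in take i (enum I)].
have sJI i : J i \subset I.
  by apply/subsetP => y; rewrite inE => /mem_take; rewrite mem_enum.
have JS i j : i <= j -> J i \subset J j.
  move=> le_ij; apply/subsetP => y; rewrite !inE -(subnKC le_ij) takeD mem_cat.
  by move=> ->.
(* The final jump to the ground set gives [x], which lies outside [S], a level above all those of
   [I]. *)
pose A i := if i <= #|I| then S :&: span (J i) else [set: T].
have homoA : {homo A : i j / i <= j >-> i \subset j}.
  move=> i j le_ij; rewrite /A; case: (leqP j) => [le_j|_]; last exact: subsetT.
  by rewrite (leq_trans le_ij le_j) setIS // spanS // JS.
have lcA i : line_closed_set M (A i).
  rewrite /A; case: ifP => [_|_ C *]; last exact: subsetT.
  apply: line_closed_setI => //; apply: line_closed_span => //.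
  exact: indep_sub indI.
have AT : A #|I|.+1 = [set: T] by rewrite /A ltnn.
have [level levelE] := chain_level homoA AT.
have lcL i : line_closed_set M [set y | level y < i].
  case: i => [|i] C C3 depC.
    suff -> : [set y | level y < 0] = set0 by rewrite set0I cards0.
    by apply/setP => y; rewrite !inE.
  have -> : [set y | level y < i.+1] = A i.
    by apply/setP => y; rewrite inE ltnS levelE.
  exact: lcA.
have indP := indM _ (preim_partition_3indep simpleM lcL).
have levelI y : y \in I -> level y <= #|I|.
  move=> yI; rewrite levelE /A leqnn inE (subsetP sIS) //=.
  by apply: (subsetP (sub_span _)); rewrite inE cardE take_size mem_enum.
have levelx : level x = #|I|.+1.
  apply/eqP; rewrite eqn_leq levelE AT inE ltnNge levelE /A leqnn inE.
  by rewrite (negPf xS).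
(* With [k] the index of [z], the set [J k] contains [y], while [z] is outside [span (J k)] because
   [z |: J k] lies in the independent [I]. *)
have lt_level y z : y \in I -> z \in I ->
    index y (enum I) < index z (enum I) -> level y < level z.
  move=> yI zI lt_yz; set k := index z (enum I) in lt_yz *.
  have ltk : k < #|I| by rewrite cardE index_mem mem_enum.
  apply: (@leq_ltn_trans k).
    rewrite levelE /A (ltnW ltk) inE (subsetP sIS) //=.
    by apply: (subsetP (sub_span _)); rewrite inE in_take // mem_enum.
  rewrite ltnNge levelE /A (ltnW ltk) inE (subsetP sIS z zI) /= inE negb_or.
  rewrite negbK inE in_take ?mem_enum // ltnn /=.
  by apply: indep_sub indI; rewrite subUset sub1set zI sJI.
have injI : {in I &, injective level}.
  move=> y z yI zI eq_yz.
  have [lt|lt|eqi] := ltngtP (index y (enum I)) (index z (enum I)).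
  - by have := lt_level _ _ yI zI lt; rewrite eq_yz ltnn.
  - by have := lt_level _ _ zI yI lt; rewrite eq_yz ltnn.
  - by apply: (index_inj y (s := enum I)); rewrite ?mem_enum.
case/negP: depxI; apply: indep_of_level indP _ _.
  move=> y z /setU1P[->|yI] /setU1P[->|zI] //; last exact: injI.
    by rewrite levelx => eqz; have := levelI z zI; rewrite -eqz ltnn.
  by rewrite levelx => eqy; have := levelI y yI; rewrite eqy ltnn.
(* The size [#|I|.+1] is at most the rank plus one, the bound built into [indep_partition]. *)
by rewrite cardsU1 xI add1n ltnS leq_rank_of ?subsetT.
Qed.

End MatroidFacts.

Theorem theorem4p4 (n l : nat) (M : matroid 'I_n)
  (M_simple : simple_matroid M) (M_rank : matroid_rank M = l) (l_ge3 : 3 <= l)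
  (M_3indep : p_indep_matroid M 3) : line_closed_matroid M.
Proof. exact: three_indep_line_closed. Qed.
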